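(* Let $Q$ be the probability generating function of a non-degenerate random variable with values in $\{0,1,2,\dots\}$ and let $k\ge1$ be an integer. Then $Q$ is Harris$(a,k)$-sum stable with scale parameter $c$ for some $a>1$ and some $c\in(0,1)$ if and only if $$Q(s)=\frac{1}{[1+\psi(1-s)]^{1/k}},\qquad 0<s<1,$$ where $\psi:[0,\infty)\to\mathbf{R}$ is continuous, $\psi(0)=0$ and $\psi(v)=a\psi(bv)$ for all $v\ge0$, with $b=c=a^{-1/\alpha}$ for some $\alpha>0$, the numbers $a$ and $k$ being the same as those in Harris$(a,k)$.
   Context: For $a>1$ and an integer $k\ge1$, the Harris$(a,k)$ law is the law of the positive-integer-valued random variable $N$ with probability generating function $P(t)=t/\{a-(a-1)t^k\}^{1/k}$. A probability generating function $Q$ of a law on $\{0,1,2,\dots\}$ is $N$-sum stable with scale parameter $c\in(0,1)$ if $P[Q(1-c+cs)]=Q(s)$ for all $s\in(0,1)$, where $P$ is the probability generating function of $N$. Harris$(a,k)$-sum stable means $N$-sum stable with $N$ having the Harris$(a,k)$ law. *)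

(* Defs.v *)
From HB Require Import structures.
From mathcomp Require Import all_boot all_order all_algebra.
From mathcomp Require Import all_classical all_reals all_analysis.

Set Implicit Arguments.
Unset Strict Implicit.
Unset Printing Implicit Defensive.

Import Order.TTheory GRing.Theory Num.Theory.
Import numFieldNormedType.Exports.

Local Open Scope classical_set_scope.
Local Open Scope ring_scope.

Definition nondegenerate_law (R : realType) (mu : probability nat R) : Prop :=
  forall n : nat, mu [set n] <> 1%E.

(* Only meaningful for t in [0, 1], where n |-> t ^+ n is integrable for every
   law; outside this interval Rintegral may return its default value. *)
Definition pgf (R : realType) (mu : probability nat R) (t : R) : R :=
  Rintegral mu setT (fun n : nat => t ^+ n).

Definition is_pgf (R : realType) (mu : probability nat R) (Q : R -> R) : Prop :=
  forall t : R, 0 <= t <= 1 -> Q t = pgf mu t.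

(* For 1 < a, 1 <= k and t in [0, 1], the base a - (a - 1) * t ^+ k is at
   least 1, so powR is the usual power here. *)
Definition is_harris (R : realType) (a : R) (k : nat)
    (nu : probability nat R) : Prop :=
  nu [set 0%N] = 0%E /\
  is_pgf nu (fun t => t / (a - (a - 1) * t ^+ k) `^ (k%:R^-1)).

(* nu is the law of N. *)
Definition sum_stable (R : realType) (nu : probability nat R)
    (Q : R -> R) (c : R) : Prop :=
  forall s : R, 0 < s < 1 -> pgf nu (Q (1 - c + c * s)) = Q s.

(* A law on nat is determined by its pgf on [0, 1], so at most one nu
   satisfies is_harris a k. *)
Definition harris_sum_stable (R : realType) (a : R) (k : nat)
    (Q : R -> R) (c : R) : Prop :=
  exists nu : probability nat R, is_harris a k nu /\ sum_stable nu Q c.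

(* psi stands for a function on [0, +oo[: its values at negative arguments are
   irrelevant. Positivity of 1 + psi (1 - s) need not be required: if it fails,
   the right-hand side is 1 or 0 by the conventions on powR and inverse, whereas
   the pgf of a nondegenerate law lies strictly between 0 and 1 on ]0, 1[. *)
Definition harris_stable_form (R : realType) (a : R) (k : nat)
    (Q : R -> R) (c : R) : Prop :=
  exists (psi : R -> R) (b alpha : R),
    [/\ {within `[0, +oo[, continuous psi},
        psi 0 = 0,
        (forall v : R, 0 <= v -> psi v = a * psi (b * v)),
        [/\ 0 < alpha, b = c & c = a `^ (- alpha^-1)]
      & forall s : R, 0 < s < 1 ->
          Q s = 1 / (1 + psi (1 - s)) `^ (k%:R^-1)].

(* Main.v *)
Require Import Defs.
From HB Require Import structures.
From mathcomp Require Import all_boot all_order all_algebra.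
From mathcomp Require Import all_classical all_reals all_analysis.
From mathcomp Require Import ring lra.
Set Implicit Arguments.
Unset Strict Implicit.
Unset Printing Implicit Defensive.

Import Order.TTheory GRing.Theory Num.Theory.
Import numFieldNormedType.Exports.
Local Open Scope classical_set_scope.
Local Open Scope ring_scope.

(* Put phi v = Q (1 - v)^(-k) - 1. In the coordinate x^(-k) - 1 the Harris pgf
   is multiplication by a, so stability with scale c says exactly that
   phi v = a phi (c v) for 0 < v < 1. Such a phi, extended by 0 to v <= 0, is
   continuous on ]-oo, 1[ and extends uniquely to all v by
   psi v = a^n phi (c^n v) for n large, which gives the form; conversely the form
   says psi = phi on ]0, 1[. The exponent alpha is just - ln a / ln c.
   The converse also needs the Harris law to exist: its pgf at t is
   t a^(-1/k) (1 - (1 - 1/a) t^k)^(-1/k), and the binomial series of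
   (1 - x)^(-1/k) has nonnegative coefficients. *)

(** * The binomial series *)

(* The Taylor coefficients of (1 - x)^(-r). *)
Fixpoint binomial_coeff (R : realType) (r : R) (j : nat) : R :=
  if j is i.+1 then binomial_coeff r i * ((r + i%:R) / i.+1%:R) else 1.

Lemma binomial_coeff_itv (R : realType) (r : R) (j : nat) :
  0 <= r <= 1 -> 0 <= binomial_coeff r j <= 1.
Proof.
move=> /andP[r0 r1]; elim: j => [|j /andP[c0 c1]] /=; first by rewrite ler01 lexx.
have j0 : 0 <= (r + j%:R) / j.+1%:R by rewrite divr_ge0// addr_ge0.
have j1 : (r + j%:R) / j.+1%:R <= 1.
  by rewrite ler_pdivrMr ?ltr0n// mul1r -natr1 addrC lerD2l.
by rewrite mulr_ge0//= mulr_ile1.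
Qed.

(** This is the differential equation (1 - x) f' = r f of f(x) = (1 - x)^(-r), read on
    coefficients. *)
Lemma pseries_diffs_binomial_coeff (R : realType) (r : R) (j : nat) :
  pseries_diffs (binomial_coeff r) j = (r + j%:R) * binomial_coeff r j.
Proof.
by rewrite /pseries_diffs /= mulrCA mulrC (mulrC j.+1%:R) divfK ?pnatr_eq0.
Qed.

(** This series, with sum 2 / (1 - x)^3, serves as a common majorant for the binomial series and its
    first two derivatives. *)
Lemma is_cvg_series_quadratic (R : realType) (x : R) : 0 <= x < 1 ->
  cvgn (series (fun j => (j.+1%:R * j.+2%:R) * x ^+ j)).
Proof.
move=> /andP[x0 x1].
(* Closed form of the partial sums, cleared of the denominator (1 - x)^3. *)
have E n : series (fun j => (j.+1%:R * j.+2%:R) * x ^+ j) n * (1 - x) ^+ 3 =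
    2 - x ^+ n * ((n.+1%:R * n.+2%:R) - 2 * n%:R * n.+2%:R * x
                  + n%:R * n.+1%:R * x ^+ 2).
  elim: n => [|n IH]; first by rewrite seriesEnat /= big_geq// mul0r expr0; ring.
  rewrite seriesSr mulrDl IH -!natr1 [x ^+ n.+1]exprS; ring.
apply: nondecreasing_is_cvgn.
  by apply: nondecreasing_series => n _ _; rewrite mulr_ge0// exprn_ge0.
exists (2 / (1 - x) ^+ 3) => _ [n _ <-].
have x3 : 0 < (1 - x) ^+ 3 by rewrite exprn_gt0// subr_gt0.
rewrite ler_pdivlMr// E lerBlDr lerDl mulr_ge0 ?exprn_ge0//.
rewrite -!natr1; have : 0 <= n%:R :> R by []; set y := n%:R => y0.
(* The bracket equals y^2 (1 - x)^2 + y (1 - x)^2 + 2 y (1 - x) + 2, a sum of nonnegative terms. *)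
have x20 : 0 <= (1 - x) * (1 - x) by rewrite -expr2 sqr_ge0.
have := mulr_ge0 (mulr_ge0 y0 y0) x20; have := mulr_ge0 y0 x20.
have : 0 <= y * (1 - x) by rewrite mulr_ge0// subr_ge0 ltW.
rewrite expr2; nra.
Qed.

Lemma is_cvg_pseries_quadratic (R : realType) (K : R) (u : nat -> R) :
  (forall j, 0 <= u j <= j.+1%:R * j.+2%:R) -> 0 <= K < 1 ->
  cvgn (pseries u K).
Proof.
move=> u01 K01; have /andP[K0 _] := K01.
apply: series_le_cvg (is_cvg_series_quadratic K01) => j.
- by rewrite mulr_ge0 ?exprn_ge0//; case/andP: (u01 j).
- by rewrite mulr_ge0 ?exprn_ge0.
- by rewrite ler_wpM2r ?exprn_ge0//; case/andP: (u01 j).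
Qed.

(** Termwise differentiation by [pseries_snd_diffs] requires these three convergences. *)
Lemma is_cvg_pseries_binomial (R : realType) (r K : R) :
  0 <= r <= 1 -> 0 <= K < 1 ->
  [/\ cvgn (pseries (binomial_coeff r) K),
      cvgn (pseries (pseries_diffs (binomial_coeff r)) K) &
      cvgn (pseries (pseries_diffs (pseries_diffs (binomial_coeff r))) K)].
Proof.
move=> r01 K01; have /andP[r0 r1] := r01.
split; apply: is_cvg_pseries_quadratic K01 => j.
- have /andP[-> c1] := binomial_coeff_itv j r01.
  by rewrite (le_trans c1)//= -natrM ler1n.
- rewrite pseries_diffs_binomial_coeff.
  have /andP[c0 c1] := binomial_coeff_itv j r01.
  rewrite mulr_ge0 ?addr_ge0//= ler_pM ?addr_ge0//.
    by rewrite -natr1 addrC lerD2l.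
  by rewrite (le_trans c1)// ler1n.
- rewrite (_ : pseries_diffs (pseries_diffs (binomial_coeff r)) j =
    j.+1%:R * pseries_diffs (binomial_coeff r) j.+1)//.
  rewrite pseries_diffs_binomial_coeff.
  have /andP[c0 c1] := binomial_coeff_itv j.+1 r01.
  have rj : 0 <= r + j.+1%:R by rewrite addr_ge0.
  apply/andP; split; first by apply: mulr_ge0 => //; apply: mulr_ge0.
  rewrite ler_wpM2l// -[leRHS]mulr1 ler_pM//.
  by rewrite -[j.+2%:R]natr1 addrC lerD2l.
Qed.

Definition binomial_series (R : realType) (r x : R) : R :=
  limn (pseries (binomial_coeff r) x).

Lemma is_derive_binomial_series (R : realType) (r x : R) :
  0 <= r <= 1 -> 0 <= x < 1 ->
  is_derive x 1 (binomial_series r) (r * binomial_series r x / (1 - x)).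
Proof.
move=> r01 x01; have /andP[x0 x1] := x01.
(* The midpoint of x and 1: differentiating at x needs convergence at a point of larger modulus,
   still below 1. *)
pose K := (1 + x) / 2.
have K01 : 0 <= K < 1 by rewrite /K; apply/andP; split; lra.
have [c0 c1 c2] := is_cvg_pseries_binomial r01 K01.
have [d0 d1 _] := is_cvg_pseries_binomial r01 x01.
have /andP[K0 _] := K01.
have xK : `|x| < `|K| by rewrite !ger0_norm// /K; lra.
apply: (is_derive_eq (pseries_snd_diffs c0 c1 c2 xK)).
rewrite /binomial_series.
set f' := limn (pseries (pseries_diffs _) x); set f := limn _.
(* The coefficient (r + j) c_j of f' splits into r c_j, which sums to r f, and j c_j, which sums to
   x f'. *)
suff E : f' = r * f + x * f'.
  by apply/(canRL (mulfK _)); [lra|rewrite mulrBr mulr1; lra].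
have f'c := pseries_diffs_equiv d1.
rewrite /f'.
apply: (@cvg_lim R) => //; rewrite [X in X @ _ --> _](_ : _ = (fun n =>
    r * pseries (binomial_coeff r) x n + x * series (fun i => i%:R * binomial_coeff r i * x ^+ i.-1) n)).
  by apply: cvgD; apply: cvgMl_tmp.
apply/funext => n; rewrite /pseries !seriesEnat/= !big_distrr/= -big_split/=.
apply: eq_bigr => -[|i] _; rewrite pseries_diffs_binomial_coeff/=.
  by rewrite !expr0; ring.
by rewrite exprS; ring.
Qed.

Lemma binomial_series0 (R : realType) (r : R) : binomial_series r 0 = 1.
Proof.
apply: (@cvg_lim R) => //.
rewrite -cvg_shiftS; apply: cvg_near_cst; near=> n.
rewrite /pseries seriesEnat/= big_nat_recl//= expr0 mulr1 big1 ?addr0// => i _.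
by rewrite expr0n mulr0.
Unshelve. all: by end_near. Qed.

Lemma binomial_series_ge0 (R : realType) (r x : R) :
  0 <= r <= 1 -> 0 <= x < 1 -> 0 <= binomial_series r x.
Proof.
move=> r01 x01; have [c _ _] := is_cvg_pseries_binomial r01 x01.
apply: limr_ge => //; near=> n; rewrite /pseries seriesEnat/=.
have /andP[x0 _] := x01.
by apply: sumr_ge0 => i _; rewrite mulr_ge0 ?exprn_ge0//;
  case/andP: (binomial_coeff_itv i r01).
Unshelve. all: by end_near. Qed.

(* The derivative of f^k (1 - x) is f^(k-1) (k (1 - x) f' - f), which vanishes. *)
Lemma binomial_series_exp (R : realType) (k : nat) (x : R) :
  (0 < k)%N -> 0 <= x < 1 -> binomial_series k%:R^-1 x ^+ k * (1 - x) = 1.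
Proof.
move=> k0 /andP[x0 x1]; have kn0 : k%:R != 0 :> R by rewrite pnatr_eq0 -lt0n.
have r01 : 0 <= (k%:R^-1 : R) <= 1.
  by rewrite invr_ge0 ler0n invf_le1 ?ltr0n// ler1n.
pose f := binomial_series (k%:R^-1 : R).
pose g : R -> R := f ^+ k * (cst 1 - id).
have dg (y : R) : 0 <= y < 1 -> is_derive y 1 g 0.
  move=> y01; have dfy := is_derive_binomial_series r01 y01.
  rewrite -/f in dfy; rewrite /g; apply: is_derive_eq.
  rewrite /cst /= !fctE /= /GRing.scale /=.
  have : 1 - y != 0 by case/andP: y01 => _ y1; rewrite subr_eq0 gt_eqF.
  case: (k) k0 kn0 => // m _ kn0 y1; rewrite /= exprS; field.
  by rewrite y1 nat1r.
have [||c _] := @MVT_segment R g (cst 0) 0 x x0.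
- move=> y; rewrite in_itv/= => /andP[y0 yx]; apply: dg.
  by rewrite (ltW y0)/= (lt_trans yx).
- by apply: derivable_within_continuous => z; rewrite in_itv/= => /andP[z0 zx];
    have [] := dg z; rewrite // z0/= (le_lt_trans zx).
rewrite /cst mul0r => /eqP; rewrite subr_eq0 => /eqP.
by rewrite /g !fctE/= /f binomial_series0 expr1n subr0 mul1r.
Qed.

(** * Existence of the Harris law *)

Lemma eseries_EFin_cvg (R : realType) (u : nat -> R) (l : R) :
  series u @ \oo --> l -> (\sum_(j <oo) (u j)%:E = l%:E)%E.
Proof.
move=> ul; apply/cvg_lim => //.
rewrite (_ : (fun n => _) = EFin \o series u); last first.
  by apply/funext => n /=; rewrite sumEFin.
by apply: cvg_EFin => //; exact: nearW.
Qed.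

(** The law is the series of Dirac masses at [x j] with weights [w j]. It is described by its
    integrals because point masses and pgf values are both integrals. *)
Lemma discrete_probability (R : realType) (w : nat -> R) (x : nat -> nat) :
  (forall j, 0 <= w j) -> series w @ \oo --> (1 : R) ->
  exists nu : probability nat R, forall g : nat -> R, (forall n, 0 <= g n) ->
    (\int[nu]_n (g n)%:E = \sum_(j <oo) (w j * g (x j))%:E)%E.
Proof.
move=> w0 w1.
pose m (j : nat) : {measure set nat -> \bar R} :=
  mscale (NngNum (w0 j)) (dirac (x j)).
have int_m (g : nat -> R) : (forall n, 0 <= g n) ->
    (\int[mseries m 0]_n (g n)%:E = \sum_(j <oo) (w j * g (x j))%:E)%E.
  move=> g0; have Eg0 n : (0 <= (g n)%:E)%E by rewrite lee_fin.
  rewrite ge0_integral_measure_series//.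
  apply: eq_eseriesr => j _; rewrite ge0_integral_mscale//=.
  by rewrite integral_dirac// diracT mul1e.
have mT : mseries m 0 setT = 1%E.
  rewrite -[LHS]mul1e -(integral_cst (mseries m 0))// (int_m (cst 1))//.
  apply: eseries_EFin_cvg; rewrite (_ : (fun j => _) = w)//.
  by apply/funext => j; rewrite mulr1.
pose nu : probability nat R := HB.pack_for (probability nat R) (mseries m 0)
  (Measure_isProbability.Build _ _ _ (mseries m 0) mT).
by exists nu.
Qed.

Lemma exists_harris (R : realType) (a : R) (k : nat) : 1 < a -> (1 <= k)%N ->
  exists nu : probability nat R, is_harris a k nu.
Proof.
move=> a1 k1; pose r : R := k%:R^-1; pose q : R := 1 - a^-1.
have a0 : 0 < a by lra.
have q01 : 0 <= q < 1.
  by rewrite /q subr_ge0 invf_le1// ltW//= ltrBlDr ltrDl invr_gt0.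
have r01 : 0 <= r <= 1 by rewrite /r invr_ge0 ler0n invf_le1 ?ltr0n// ler1n.
(* The mass at 1 + k j, read off from the expansion of t a^(-1/k) (1 - q t^k)^(-1/k). *)
pose w j := binomial_coeff r j * q ^+ j / a `^ r.
have /andP[q0 q1] := q01.
have w0 j : 0 <= w j.
  have /andP[c0 _] := binomial_coeff_itv j r01.
  by rewrite divr_ge0 ?powR_ge0// mulr_ge0// exprn_ge0.
have gen (t : R) : 0 <= t <= 1 ->
    series (fun j => w j * t ^+ (1 + k * j)) @ \oo -->
      t / (a - (a - 1) * t ^+ k) `^ r.
  move=> /andP[t0 t1]; pose y := q * t ^+ k.
  have tk0 : 0 <= t ^+ k by rewrite exprn_ge0.
  have tk1 : t ^+ k <= 1 by rewrite exprn_ile1.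
  have y01 : 0 <= y < 1.
    rewrite /y mulr_ge0//= (le_lt_trans _ q1)// -[leRHS]mulr1 ler_wpM2l//.
  have [yc _ _] := is_cvg_pseries_binomial r01 y01.
  have f0 := binomial_series_ge0 r01 y01.
  have fk := binomial_series_exp k1 y01.
  have y10 : 0 < 1 - y by case/andP: y01; lra.
  (* Both sides are nonnegative, so equality of their k-th powers suffices. *)
  have fE : binomial_series r y = ((1 - y) `^ r)^-1.
    apply/(@pexpIrn _ k); rewrite ?qualifE/= ?invr_ge0 ?powR_ge0//.
    rewrite exprVn -[in RHS]powR_mulrn ?powR_ge0// -powRrM mulVf ?pnatr_eq0 -?lt0n//.
    rewrite powRr1 ?(ltW y10)//; apply: (mulIf (lt0r_neq0 y10)).
    by rewrite fk mulVf// lt0r_neq0.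
  have -> : a - (a - 1) * t ^+ k = a * (1 - y).
    by rewrite /y /q; field; rewrite gt_eqF.
  rewrite powRM ?ltW// invfM mulrA -fE.
  rewrite (_ : series _ = (fun n => t / a `^ r * pseries (binomial_coeff r) y n)).
    exact: cvgMl_tmp.
  apply/funext => n; rewrite /pseries !seriesEnat/= big_distrr/=.
  apply: eq_bigr => j _; rewrite /w /y exprMn exprD exprM expr1; ring.
(* The total mass is the generating function at t = 1, where the base a - (a - 1) t^k is 1. *)
have w1 : series w @ \oo --> (1 : R).
  have := gen 1; rewrite ler01 lexx => /(_ isT).
  rewrite expr1n mulr1 opprB addrC subrK powR1 invr1 mulr1.
  by rewrite (_ : (fun j => _) = w)//; apply/funext => j; rewrite expr1n mulr1.
have [nu nuE] := discrete_probability (fun j => 1 + k * j)%N w0 w1.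
exists nu; split.
  have := nuE (\1_[set 0%N]) (fun=> ler0n _ _); rewrite integral_indic// setIT => ->.
  by rewrite eseries0// => j _ _; rewrite indicE memNset ?mulr0.
move=> t t01; rewrite /pgf /Rintegral nuE; last first.
  by move=> n; rewrite exprn_ge0//; case/andP: t01.
by rewrite (eseries_EFin_cvg (gen t t01)).
Qed.

(** * Probability generating functions on [0, 1] *)

Lemma integrable_unit_itv (R : realType) (mu : probability nat R) (g : nat -> R) :
  (forall n, 0 <= g n <= 1) -> mu.-integrable setT (EFin \o g).
Proof.
move=> g01; apply: measurable_bounded_integrable => //.
  by rewrite (le_lt_trans (probability_le1 _ _))// ltry.
exists 1; split => // M M1 n _ /=.
by have /andP[g0 g1] := g01 n; rewrite ger0_norm// (le_trans g1)// ltW.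
Qed.

(** A nonnegative function with zero integral vanishes almost everywhere, so its zero set would have
    probability 1. *)
Lemma Rintegral_gt0 (R : realType) (mu : probability nat R) (g : nat -> R) :
  (forall n, 0 <= g n <= 1) -> mu [set n | g n = 0] <> 1%E ->
  0 < Rintegral mu setT g.
Proof.
move=> g01 g_neq0; have g0 n : 0 <= g n by case/andP: (g01 n).
rewrite lt_neqAle Rintegral_ge0// andbT eq_sym.
apply: contra_notN g_neq0 => /eqP int0.
have : (\int[mu]_n `|(g n)%:E| = 0)%E.
  under eq_integral do rewrite gee0_abs ?lee_fin//.
  rewrite -[LHS]fineK -?[fine _]/(Rintegral mu setT g) ?int0//.
  exact/integrable_fin_num/integrable_unit_itv.
move/ae_eq_integral_abs => /(_ measurableT) H.
have [|N [_ muN0 subN]] := H; first by [].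
have : mu (~` [set n | g n = 0]) = 0%E.
  apply/(subset_measure0 _ _ _ muN0) => // n /= gn0; apply: subN => /= /(_ I).
  by move=> [].
rewrite probability_setC// => /eqP; rewrite sube_eq ?fin_num_measure//.
by rewrite add0e => /eqP.
Qed.

Lemma pgf1 (R : realType) (mu : probability nat R) : pgf mu 1 = 1.
Proof.
rewrite /pgf /Rintegral; under eq_integral do rewrite expr1n.
by rewrite (integral_cst mu measurableT 1%E) mul1e [X in fine X]probability_setT.
Qed.

Lemma pgf_itv01 (R : realType) (mu : probability nat R) (t : R) :
  0 <= t <= 1 -> 0 <= pgf mu t <= 1.
Proof.
move=> /andP[t0 t1]; have tn n : 0 <= t ^+ n <= 1 by rewrite exprn_ge0// exprn_ile1.
apply/andP; split; first by apply: Rintegral_ge0 => n _; rewrite exprn_ge0.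
rewrite -(pgf1 mu); apply: le_Rintegral => //; try exact: integrable_unit_itv.
  by apply: integrable_unit_itv => n; rewrite expr1n ler01 lexx.
by move=> n _; rewrite expr1n; case/andP: (tn n).
Qed.

Lemma pgf_gt0 (R : realType) (mu : probability nat R) (t : R) :
  0 < t <= 1 -> 0 < pgf mu t.
Proof.
move=> /andP[t0 t1]; apply: Rintegral_gt0.
  by move=> n; rewrite exprn_ge0 ?exprn_ile1// ltW.
rewrite (_ : [set n | _] = set0) ?measure0.
  by move=> /esym/eqP; rewrite onee_eq0.
by apply/seteqP; split=> n //= /eqP; rewrite expf_eq0 gt_eqF// andbF.
Qed.

(** 1 - [pgf mu t] is the integral of 1 - t^n, which vanishes only at n = 0, and nondegeneracy
    forbids full mass there. *)
Lemma pgf_lt1 (R : realType) (mu : probability nat R) (t : R) :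
  nondegenerate_law mu -> 0 < t < 1 -> pgf mu t < 1.
Proof.
move=> mu_nd /andP[t0 t1].
have tn n : 0 <= t ^+ n <= 1 by rewrite exprn_ge0 ?exprn_ile1// ltW.
rewrite -subr_gt0 -(pgf1 mu) /pgf -RintegralB//; try exact: integrable_unit_itv.
  apply: Rintegral_gt0.
    by move=> n; rewrite expr1n subr_ge0 gerBl; case/andP: (tn n) => -> ->.
  rewrite (_ : [set n | _] = [set 0%N])//; apply/seteqP; split=> n /=.
    rewrite expr1n; case: n => // n /eqP; rewrite subr_eq0 eq_sym.
    by rewrite lt_eqF// exprn_ilt1// ltW.
  by move=> ->; rewrite !expr0 subrr.
by apply: integrable_unit_itv => n; rewrite expr1n ler01 lexx.
Qed.

(* Clamping the argument makes a pgf continuous on the whole line, which avoids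
   one-sided continuity at 1. *)
Definition unit_clamp (R : realType) (t : R) : R := Num.max 0 (Num.min 1 t).

Lemma unit_clamp_itv01 (R : realType) (t : R) : 0 <= unit_clamp t <= 1.
Proof. by rewrite /unit_clamp le_max lexx ge_max ler01 ge_min lexx. Qed.

Lemma unit_clamp_id (R : realType) (t : R) : 0 <= t <= 1 -> unit_clamp t = t.
Proof. by move=> /andP[t0 t1]; rewrite /unit_clamp (min_idPr t1) (max_idPr t0). Qed.

Lemma unit_clamp_ge1 (R : realType) (t : R) : 1 <= t -> unit_clamp t = 1.
Proof. by move=> t1; rewrite /unit_clamp (min_idPl t1) (max_idPr ler01). Qed.

Lemma continuous_unit_clamp (R : realType) : continuous (@unit_clamp R).
Proof.
move=> t; apply: (@continuous_max R R (cst 0) _ t); first exact: cvg_cst.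
by apply: (@continuous_min R R (cst 1) id t); [exact: cvg_cst|exact: cvg_id].
Qed.

(** Continuity under the integral sign: the integrands are continuous in t and dominated by the
    constant 1. *)
Lemma continuous_pgf_clamp (R : realType) (mu : probability nat R) :
  continuous (fun t : R => pgf mu (unit_clamp t)).
Proof.
move=> t.
have tn (s : R) n : 0 <= unit_clamp s ^+ n <= 1.
  by case/andP: (unit_clamp_itv01 s) => s0 s1; rewrite exprn_ge0 ?exprn_ile1.
apply: (@continuity_under_integral _ _ _ mu
  (fun s n => unit_clamp s ^+ n) setT measurableT (t - 1) (t + 1) _ _ (cst 1)).
- by move=> s _; exact: integrable_unit_itv.
- apply: aeW => n _ s _.
  apply: (@continuous_comp R R R (@unit_clamp R) (fun x => x ^+ n)).
    exact: continuous_unit_clamp.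
  exact: exprn_continuous.
- by apply: integrable_unit_itv => n; rewrite ler01 lexx.
- move=> s _; apply: aeW => n _; have /andP[s0 s1] := tn s n.
  by rewrite ger0_norm.
- by rewrite inE/= in_itv/=; apply/andP; split; lra.
Qed.

(** * The scaling equation *)

Lemma powR_invn_eq (R : realType) (k : nat) (x y : R) :
  (1 <= k)%N -> 0 < x -> 0 < y -> (x = y `^ k%:R^-1) <-> x ^+ k = y.
Proof.
move=> k1 x0 y0; have k0 : k%:R != 0 :> R by rewrite pnatr_eq0 -lt0n.
have yk : (y `^ k%:R^-1) ^+ k = y.
  by rewrite -powR_mulrn ?powR_ge0// -powRrM mulVf// powRr1// ltW.
split=> [-> //|xy]; apply/(@pexpIrn _ k) => //; rewrite ?qualifE/= ?powR_ge0 ?ltW//.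
by rewrite yk.
Qed.

(** Taking k-th powers gives (q / p)^k = a - (a - 1) q^k; dividing by q^k makes the right side 1 + a
    (q^(-k) - 1). *)
Lemma harris_pgf_eq (R : realType) (a : R) (k : nat) (q p : R) :
  1 < a -> (1 <= k)%N -> 0 < q <= 1 -> 0 < p ->
  q / (a - (a - 1) * q ^+ k) `^ k%:R^-1 = p <-> p ^- k - 1 = a * (q ^- k - 1).
Proof.
move=> a1 k1 /andP[q0 q1] p0.
have u0 : 0 < q ^+ k by rewrite exprn_gt0.
have u1 : q ^+ k <= 1 by rewrite exprn_ile1// ltW.
have v0 : 0 < p ^+ k by rewrite exprn_gt0.
set D := a - _; have D0 : 0 < D by rewrite /D; nra.
have -> : (q / D `^ k%:R^-1 = p) <-> (q / p = D `^ k%:R^-1).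
  split=> [<-|<-]; first by rewrite invfM invrK mulrA divff ?mul1r// gt_eqF.
  by rewrite invfM invrK mulrA divff ?mul1r// gt_eqF.
rewrite powR_invn_eq ?divr_gt0// expr_div_n.
have -> : q ^+ k / p ^+ k = D <-> p ^- k = D / q ^+ k.
  split=> [<-|->]; first by rewrite mulrAC divff ?mul1r// gt_eqF.
  by rewrite mulrC divfK// gt_eqF.
have -> : D / q ^+ k = 1 + a * (q ^- k - 1).
  by rewrite /D; field; rewrite gt_eqF.
by split=> [->|/eqP]; [rewrite addrC addKr|rewrite subr_eq addrC => /eqP].
Qed.

(* If 1 + p <= 0, powR takes the junk values 1 or 0, excluded by 0 < q < 1, while
   p = q ^- k - 1 makes 1 + p positive. *)
Lemma harris_form_eq (R : realType) (k : nat) (q p : R) :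
  (1 <= k)%N -> 0 < q < 1 ->
  q = 1 / (1 + p) `^ k%:R^-1 <-> p = q ^- k - 1.
Proof.
move=> k1 /andP[q0 q1].
have k0 : k%:R^-1 != 0 :> R by rewrite invr_neq0// pnatr_eq0 -lt0n.
have inv_q : q = 1 / (1 + p) `^ k%:R^-1 <-> q^-1 = (1 + p) `^ k%:R^-1.
  by rewrite div1r; split=> [->|<-]; rewrite invrK.
rewrite inv_q; have [p0|p0|p0] := ltrgt0P (1 + p).
- rewrite powR_invn_eq ?invr_gt0// exprVn.
  by split=> ->; [rewrite addrC addKr|rewrite addrC subrK].
- rewrite lt0_powR1//; split=> [/eqP|pE].
    by rewrite invr_eq1 lt_eqF.
  by move: p0; rewrite pE addrC subrK ltNge invr_ge0 exprn_ge0// ltW.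
- rewrite p0 powR0//; split=> [/eqP|pE]; first by rewrite invr_eq0 gt_eqF.
  by move/eqP: p0; rewrite pE addrC subrK invr_eq0 expf_eq0 gt_eqF// andbF.
Qed.

Lemma exists_expr_lt1 (R : realType) (c v : R) : 0 < c < 1 ->
  exists n, c ^+ n * v < 1.
Proof.
move=> /andP[c0 c1].
have := @cvg_geometric R `|v| c; rewrite (ger0_norm (ltW c0)) => /(_ c1).
move=> /cvgr0_norm_lt /(_ 1 ltr01) [n _ /(_ n (leqnn n))] /=.
rewrite /geometric/= normrM normr_id normrX (ger0_norm (ltW c0)) => H.
exists n; apply: le_lt_trans H.
by rewrite mulrC ler_wpM2r ?ler_norm// exprn_ge0// ltW.
Qed.

(** Powers of c bring every v below 1, where phi is known, and the equation then dictates the value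
    at v. *)
Lemma scaling_extension (R : realType) (phi : R -> R) (a c : R) :
  0 < c < 1 ->
  (forall v, v < 1 -> {for v, continuous phi}) ->
  (forall v, v < 1 -> phi v = a * phi (c * v)) ->
  exists psi : R -> R, [/\ continuous psi,
    forall v, psi v = a * psi (c * v) & forall v, v < 1 -> psi v = phi v].
Proof.
move=> c01 phi_cont phi_scale; have /andP[c0 c1] := c01.
have lt1 n v : v < 1 -> c ^+ n * v < 1.
  move=> v1; have [v0|v0] := lerP v 0.
    by rewrite (le_lt_trans _ ltr01)// mulr_ge0_le0// exprn_ge0// ltW.
  by rewrite (le_lt_trans _ v1)// ger_pMl// exprn_ile1// ltW.
have phi_iter n v : v < 1 -> phi v = a ^+ n * phi (c ^+ n * v).
  elim: n v => [|n IH] v v1; first by rewrite !expr0 !mul1r.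
  by rewrite IH// phi_scale ?lt1// mulrA mulrA -exprSr -exprS.
have [N NP] := choice (fun v => exists_expr_lt1 v c01).
pose psi v := a ^+ N v * phi (c ^+ N v * v).
(* Any admissible exponent gives the same value: iterating the equation from the smaller exponent
   reaches the larger one. *)
have psiE n v : c ^+ n * v < 1 -> psi v = a ^+ n * phi (c ^+ n * v).
  move=> nv; rewrite /psi; have [le_n|/ltnW le_n] := leqP n (N v).
    rewrite [in RHS](phi_iter (N v - n)%N)// !mulrA -!exprD.
    by rewrite addnC subnK.
  rewrite (phi_iter (n - N v)%N (c ^+ N v * v))// !mulrA -!exprD.
  by rewrite addnC !subnK.
exists psi; split.
(* The exponent chosen at v stays admissible nearby, so psi agrees near v with a single continuous
   expression. *)
- move=> v; pose n := N v; have nv : c ^+ n * v < 1 by exact: NP.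
  have scale_cont : c ^+ n * x @[x --> v] --> c ^+ n * v.
    by apply: cvgMl_tmp; exact: cvg_id.
  rewrite /continuous_at (psiE n)//.
  have near_psi : {near v, (fun x => a ^+ n * phi (c ^+ n * x)) =1 psi}.
    by near=> x; apply/esym/psiE; near: x; exact: cvgr_lt scale_cont _ nv.
  apply: cvg_trans (near_eq_cvg near_psi) _; apply: cvgMl_tmp.
  exact: continuous_comp scale_cont (phi_cont _ nv).
(* An exponent admissible for c v, increased by one, is admissible for v. *)
- move=> v; have Ncv := NP (c * v); have := Ncv; rewrite mulrA -exprSr => Nv.
  by rewrite (psiE _ _ Nv) /psi mulrA -exprS [c ^+ _ * (c * v)]mulrA -exprSr.
- by move=> v v1; rewrite (psiE 0%N) ?expr0 ?mul1r.
Unshelve. all: by end_near. Qed.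

(** * Stability and the explicit form as the scaling equation *)

(** With v = 1 - s the argument 1 - c + c s becomes 1 - c v, and [harris_pgf_eq] applies pointwise.
    The right-to-left direction takes its law from [exists_harris]. *)
Lemma harris_sum_stable_scaling (R : realType) (mu : probability nat R)
    (Q : R -> R) (a c : R) (k : nat) :
  is_pgf mu Q -> 1 < a -> (1 <= k)%N -> 0 < c < 1 ->
  harris_sum_stable a k Q c <->
  (forall v : R, 0 < v < 1 -> Q (1 - v) ^- k - 1 = a * (Q (1 - c * v) ^- k - 1)).
Proof.
move=> QE a1 k1 /andP[c0 c1].
have Q01 t : 0 < t <= 1 -> 0 < Q t <= 1.
  move=> t01; have /andP[t0 t1] := t01.
  have t01' : 0 <= t <= 1 by rewrite ltW.
  by rewrite QE// pgf_gt0//; case/andP: (pgf_itv01 mu t01').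
have stableE nu : is_harris a k nu -> sum_stable nu Q c <->
    forall v : R, 0 < v < 1 -> Q (1 - v) ^- k - 1 = a * (Q (1 - c * v) ^- k - 1).
  move=> [_ nuE].
  have pointwise (v : R) : 0 < v < 1 -> pgf nu (Q (1 - c * v)) = Q (1 - v) <->
      Q (1 - v) ^- k - 1 = a * (Q (1 - c * v) ^- k - 1).
    move=> /andP[v0 v1].
    have /andP[cv0 cv1] : 0 < c * v < 1 by rewrite mulr_gt0//= mulr_ilt1 ?ltW.
    have q01 : 0 < Q (1 - c * v) <= 1 by apply: Q01; apply/andP; split; lra.
    have /andP[p0 _] : 0 < Q (1 - v) <= 1 by apply: Q01; apply/andP; split; lra.
    rewrite -nuE; last by case/andP: q01 => /ltW -> ->.
    exact: harris_pgf_eq.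
  split=> [stable v v01|scaling s s01].
    apply/pointwise => //; rewrite -(stable (1 - v)); last by apply/andP; split; lra.
    by congr (pgf nu (Q _)); ring.
  have v01 : 0 < 1 - s < 1 by apply/andP; split; lra.
  have -> : 1 - c + c * s = 1 - c * (1 - s) by ring.
  by rewrite ((pointwise _ v01).2 (scaling _ v01)) subKr.
split=> [[nu [nu_harris /(stableE _ nu_harris)]]//|scaling].
have [nu nu_harris] := exists_harris a1 k1.
by exists nu; split=> //; apply/stableE.
Qed.

(** On ]0, 1[ the form forces psi v = Q (1 - v)^(-k) - 1. Conversely [scaling_extension] turns this
    local function into psi. *)
Lemma harris_stable_form_scaling (R : realType) (mu : probability nat R)
    (Q : R -> R) (a c : R) (k : nat) :
  nondegenerate_law mu -> is_pgf mu Q -> 1 < a -> (1 <= k)%N -> 0 < c < 1 ->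
  harris_stable_form a k Q c <->
  (forall v : R, 0 < v < 1 -> Q (1 - v) ^- k - 1 = a * (Q (1 - c * v) ^- k - 1)).
Proof.
move=> mu_nd QE a1 k1 c01; have /andP[c0 c1] := c01.
have Q01 t : 0 < t < 1 -> 0 < Q t < 1.
  move=> t01; have /andP[t0 t1] := t01.
  by rewrite QE ?pgf_gt0 ?pgf_lt1// ?t0 ?ltW.
split=> [[psi [b [alpha [_ _ psi_scale [_ bc _] formQ]]]] v v01|scaling].
  have psiE w : 0 < w < 1 -> psi w = Q (1 - w) ^- k - 1.
    move=> w01; have w01' : 0 < 1 - w < 1 by apply/andP; split; lra.
    apply/harris_form_eq => //; first exact: Q01.
    by rewrite formQ// subKr.
  have /andP[v0 v1] := v01.
  have /andP[cv0 cv1] : 0 < c * v < 1 by rewrite mulr_gt0//= mulr_ilt1 ?ltW.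
  by rewrite -!psiE ?cv0// psi_scale ?ltW// bc.
(* Since F is 1 beyond 1, phi below is 0 for v <= 0 and continuous across 0, which yields psi 0 =
   0. *)
pose F t := pgf mu (unit_clamp t).
have FE t : 0 <= t <= 1 -> F t = Q t by move=> t01; rewrite /F unit_clamp_id// QE.
have F_ge1 t : 1 <= t -> F t = 1 by move=> t1; rewrite /F unit_clamp_ge1// pgf1.
(* The bound v < 1 keeps the argument positive; at v = 1 the pgf may vanish, if the law has no mass
   at 0. *)
have F_neq0 v : v < 1 -> F (1 - v) != 0.
  move=> v1; rewrite gt_eqF//; have [v0|v0] := lerP v 0.
    by rewrite F_ge1 ?ltr01//; lra.
  by rewrite /F unit_clamp_id; [apply: pgf_gt0; apply/andP; split; lra
    | apply/andP; split; lra].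
pose phi v := F (1 - v) ^- k - 1.
have phi_cont v : v < 1 -> {for v, continuous phi}.
  move=> v1; apply: cvgB; last exact: cvg_cst.
  apply: cvgV; first by rewrite expf_neq0// F_neq0.
  apply: (@continuous_comp R R R (fun x => F (1 - x)) (fun x => x ^+ k)).
    apply: (@continuous_comp R R R (fun x => 1 - x) F).
      by apply: cvgB; [exact: cvg_cst|exact: cvg_id].
    exact: continuous_pgf_clamp.
  exact: exprn_continuous.
have phi_scale v : v < 1 -> phi v = a * phi (c * v).
  move=> v1; rewrite /phi; have [v0|v0] := lerP v 0.
    by rewrite !F_ge1 ?expr1n ?invr1 ?subrr ?mulr0//; nra.
  have /andP[cv0 cv1] : 0 < c * v < 1 by rewrite mulr_gt0//= mulr_ilt1 ?ltW.
  by rewrite !FE; [apply: scaling; rewrite v0|apply/andP; split; lra..].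
have [psi [psi_cont psi_scale psiE]] := scaling_extension c01 phi_cont phi_scale.
have lna : 0 < ln a by rewrite ln_gt0.
have lnc : ln c < 0 by rewrite ln_lt0// c0.
exists psi, c, (- (ln a / ln c)); split.
- exact: continuous_subspaceT.
- by rewrite psiE ?ltr01// /phi subr0 F_ge1// expr1n invr1 subrr.
- by move=> v _; exact: psi_scale.
(* alpha is positive as ln a > 0 > ln c, and a^(-1/alpha) = exp ((ln c / ln a) ln a) = c. *)
- split=> //; first by rewrite oppr_gt0 pmulr_rlt0// invr_lt0.
  rewrite invrN opprK invf_div /powR gt_eqF; last by lra.
  by rewrite divfK ?gt_eqF// lnK.
- move=> s s01; have /andP[s0 s1] := s01.
  apply/harris_form_eq => //; first exact: Q01.
  by rewrite psiE ?/phi ?subKr ?FE ?ltW//; lra.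
Qed.

(* The first conjunct is the equivalence with a and c existentially quantified
   on each side; the second one says that the same a (and c) serve on both
   sides. *)
Theorem theorem3p3 (R : realType) (d : measure_display) (T : measurableType d)
    (Pr : probability T R) (X : {RV Pr >-> nat}) (Q : R -> R) (k : nat)
    (hX : nondegenerate_law (distribution Pr X))
    (hQ : is_pgf (distribution Pr X) Q)
    (hk : (1 <= k)%N) :
  ((exists a c : R, [/\ 1 < a, 0 < c < 1 & harris_sum_stable a k Q c]) <->
   (exists a c : R, [/\ 1 < a, 0 < c < 1 & harris_stable_form a k Q c])) /\
  (forall a c : R, 1 < a -> 0 < c < 1 ->
     harris_sum_stable a k Q c <-> harris_stable_form a k Q c).
Proof.
have stable_iff_form a c : 1 < a -> 0 < c < 1 ->
    harris_sum_stable a k Q c <-> harris_stable_form a k Q c.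
  move=> a1 c01; apply: iff_trans (harris_sum_stable_scaling hQ a1 hk c01) _.
  by apply: iff_sym; exact: harris_stable_form_scaling hX hQ a1 hk c01.
split=> //.
by split=> -[a [c [a1 c01 H]]]; exists a, c; split=> //; apply/stable_iff_form.
Qed.
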